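(* Let $d\ge 1$ and let $G\subset\mathbb{T}_{\max}^{d+1}$ be a finite set such that every $g\in G$ satisfies $0\in\operatorname{supp}(g)$ and $\operatorname{supp}(g)\neq\{0\}$. Then the set $\overline{W}(G)$ is a $\min$-tropical cone in $\mathbb{T}_{\min}^{d+1}$. More precisely, if $\mathcal{H}$ is a finite set of $\max$-tropical halfspaces in $\mathbb{T}_{\max}^{d+1}$ such that $\bigcap\mathcal{H}=\overline{M}(G)$, and $A\subset\mathbb{T}_{\min}^{d+1}$ is the set of apices of the tropical halfspaces in $\mathcal{H}$, then \[ W(G)\;=\;-M(-A). \] In particular, the set $A\cup\mathcal{E}_{\min}$ generates the $\min$-tropical cone $\overline{W}(G)$.
   Context: $\mathbb{T}_{\min}=\mathbb{R}\cup\{\infty\}$ with tropical addition $\min$ and tropical multiplication $+$; $\mathbb{T}_{\max}=\mathbb{R}\cup\{-\infty\}$ with $\max$ and $+$. Both carry the order topology, and powers carry the product topology. Coordinates of vectors in $\mathbb{T}_{\min}^{d+1}$, $\mathbb{T}_{\max}^{d+1}$ are indexed by $0,1,\dots,d$. The support $\operatorname{supp}(a)$ is the set of indices $i$ with $a_i\neq\infty$ (if $a\in\mathbb{T}_{\min}^{d+1}$), respectively $a_i\neq-\infty$ (if $a\in\mathbb{T}_{\max}^{d+1}$). Negation maps $\mathbb{T}_{\min}^{d+1}$ to $\mathbb{T}_{\max}^{d+1}$ and vice versa; $-S=\{-s : s\in S\}$. A $\min$-tropical cone is a nonempty subset $C\subseteq\mathbb{T}_{\min}^{d+1}$ such that for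 all $x,y\in C$ and $\lambda,\mu\in\mathbb{T}_{\min}$ the vector $(\min(\lambda+x_i,\mu+y_i))_{i=0,\dots,d}$ lies in $C$; a $\max$-tropical cone is defined likewise with $\max$ and $\mathbb{T}_{\max}$. A set generates $C$ if $C$ is the smallest tropical cone containing it. $\mathcal{E}_{\min}=\{e^{(1)},\dots,e^{(d)}\}\subset\mathbb{T}_{\min}^{d+1}$, where $e^{(i)}$ has $i$-th entry $0$ and all other entries $\infty$ (note that $e^{(0)}$ is omitted). A $\max$-tropical halfspace with apex $a\in\mathbb{T}_{\min}^{d+1}$ of type $(I,J)$, where $I,J$ are disjoint nonempty sets with $I\sqcup J=\operatorname{supp}(a)$, is the set $\{x\in\mathbb{T}_{\max}^{d+1} : \max(x_i-a_i\mid i\in I)\le\max(x_j-a_j\mid j\in J)\}$. (Any $\max$-tropical halfspace containing a set $\overline{M}(G)$ with $G\ne\emptyset$ has type $(\{0\},J)$, so its apex has $0$ in its support.) For a finite set $G\subset\mathbb{T}_{\max}^{d+1}$ with $0\in\operatorname{supp}(g)$ for all $g\in G$, define \[ \overline{M}(G)=\bigcup_{g\in G}\{x\in\mathbb{T}_{\max}^{d+1} : x_0-g_0\le\min(x_j-g_j\mid j\in\operatorname{supp}(g)\setminus\{0\})\},\qquad M(G)=\overline{M}(G)\cap\mathbb{R}^{d+1}. \] $W(G)$ denotes the closure in $\mathbb{R}^{d+1}$ of $\mathbb{R}^{d+1}\setminus M(G)$, and $\overline{W}(G)$ denotes the closure of $W(G)$ in $\mathbb{T}_{\min}^{d+1}$.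 *)

(* Defs.v *)
From HB Require Import structures.
From mathcomp Require Import all_boot all_order all_algebra.
From mathcomp Require Import all_classical all_reals all_analysis.

Set Implicit Arguments.
Unset Strict Implicit.
Unset Printing Implicit Defensive.

Import Order.TTheory GRing.Theory Num.Theory.
Import numFieldNormedType.Exports.

Local Open Scope classical_set_scope.
Local Open Scope ring_scope.

(* The semirings T_min = R u {+oo} and T_max = R u {-oo} are the subsets of
   [\bar R] omitting -oo, respectively +oo; as order-convex subsets, their
   order topology is the one induced by [\bar R].  Vectors with coordinates
   0, ..., d are rows of size d.+1, the topology on rows being the product
   topology. *)
Definition Tmin (R : realType) (d : nat) : set 'rV[\bar R]_d.+1 :=
  [set x | forall i, x ord0 i != -oo%E].

Definition Tmax (R : realType) (d : nat) : set 'rV[\bar R]_d.+1 :=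
  [set x | forall i, x ord0 i != +oo%E].

Definition real_vec (R : realType) (d : nat) (x : 'rV[R]_d.+1) :
    'rV[\bar R]_d.+1 :=
  map_mx EFin x.

Definition trop_opp (R : realType) (d : nat) (x : 'rV[\bar R]_d.+1) :
    'rV[\bar R]_d.+1 :=
  map_mx oppe x.

(* On [Tmin] a coordinate is finite iff it differs from +oo; on [Tmax], iff it
   differs from -oo. *)
Definition supp (R : realType) (d : nat) (a : 'rV[\bar R]_d.+1) :
    {set 'I_d.+1} :=
  [set i : 'I_d.+1 | a ord0 i \is a fin_num]%SET.

Definition min_comb (R : realType) (d : nat) (l m : \bar R)
    (x y : 'rV[\bar R]_d.+1) : 'rV[\bar R]_d.+1 :=
  \row_i mine (l + x ord0 i)%E (m + y ord0 i)%E.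

Definition min_tropical_cone (R : realType) (d : nat)
    (C : set 'rV[\bar R]_d.+1) : Prop :=
  [/\ C !=set0, C `<=` @Tmin R d &
      forall (x y : 'rV[\bar R]_d.+1) (l m : \bar R), C x -> C y ->
        l != -oo%E -> m != -oo%E -> C (min_comb l m x y)].

Definition min_generates (R : realType) (d : nat)
    (S C : set 'rV[\bar R]_d.+1) : Prop :=
  [/\ min_tropical_cone C, S `<=` C &
      forall D, min_tropical_cone D -> S `<=` D -> C `<=` D].

Definition unit_min (R : realType) (d : nat) (i : 'I_d.+1) :
    'rV[\bar R]_d.+1 :=
  \row_j (if j == i then 0%E else +oo%E).

Definition Emin (R : realType) (d : nat) : set 'rV[\bar R]_d.+1 :=
  [set unit_min R i | i in [set i : 'I_d.+1 | i != ord0]].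

Definition max_halfspace (R : realType) (d : nat) (a : 'rV[\bar R]_d.+1)
    (I J : {set 'I_d.+1}) : set 'rV[\bar R]_d.+1 :=
  [set x | @Tmax R d x /\
    (\big[maxe/-oo]_(i in I) (x ord0 i - a ord0 i)
     <= \big[maxe/-oo]_(j in J) (x ord0 j - a ord0 j))%E].

(* A tropical scalar multiple of an apex of [h] is again an apex of [h]. *)
Definition is_apex (R : realType) (d : nat) (a : 'rV[\bar R]_d.+1)
    (h : set 'rV[\bar R]_d.+1) : Prop :=
  @Tmin R d a /\ exists I J : {set 'I_d.+1},
    [/\ I <> finset.set0, J <> finset.set0, (I :&: J)%SET = finset.set0,
        (I :|: J)%SET = supp a & h = max_halfspace a I J].

(* [A] is a set of apices of the halfspaces in [H]: all its elements are such
   apices, and every halfspace in [H] contributes at least one (or several,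
   possibly all, since the apex is only determined up to tropical scaling). *)
Definition apices (R : realType) (d : nat) (H : set (set 'rV[\bar R]_d.+1))
    (A : set 'rV[\bar R]_d.+1) : Prop :=
  (forall a, A a -> exists2 h, H h & is_apex a h) /\
  (forall h, H h -> exists2 a, A a & is_apex a h).

Definition Mbar (R : realType) (d : nat) (G : set 'rV[\bar R]_d.+1) :
    set 'rV[\bar R]_d.+1 :=
  \bigcup_(g in G) [set x | @Tmax R d x /\
    (x ord0 ord0 - g ord0 ord0
     <= \big[mine/+oo]_(j in supp g :\ ord0) (x ord0 j - g ord0 j))%E].

Definition M (R : realType) (d : nat) (G : set 'rV[\bar R]_d.+1) :
    set 'rV[R]_d.+1 :=
  [set x | Mbar G (real_vec x)].

Definition W (R : realType) (d : nat) (G : set 'rV[\bar R]_d.+1) :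
    set 'rV[R]_d.+1 :=
  closure (~` M G).

Definition Wbar (R : realType) (d : nat) (G : set 'rV[\bar R]_d.+1) :
    set 'rV[\bar R]_d.+1 :=
  closure (@real_vec R d @` W G) `&` @Tmin R d.

(* Main.v *)
Require Import Defs.
From mathcomp Require Import all_boot all_order all_algebra.
From mathcomp Require Import all_classical all_reals all_analysis.
From mathcomp Require Import lra.

Import Order.TTheory GRing.Theory Num.Theory.
Import numFieldNormedType.Exports.

Local Open Scope classical_set_scope.
Local Open Scope ring_scope.

(* [Wbar G] is the intersection [K] of the min-halfspaces
   [min_j (x_j - g_j) <= x_0 - g_0] for [g] in [G], and [W G] is its real part:
   increasing [x_0] slightly leaves [M G], and a point of [K] is approximated by
   its min-combinations with [t] times a fixed real point of [K], as [t] tends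
   to infinity.  The other inclusions hold because these halfspaces are closed.

   Every halfspace of [H] has type [({0}, J)], since [Mbar G] contains all
   points with [x_0 = -oo].  Let [x] be in [K] with [x_0] finite.  Points close
   to [x] outside [Mbar G] violate some halfspace of [H]; as [H] is finite, one
   halfspace is violated arbitrarily close to [x], so that its apices [a]
   satisfy [x_j - a_j <= x_0 - a_0] for all [j] in the support of [a].  These
   inequalities describe [- M (- A)], and they also say that [x] is the
   min-combination of [(x_0 - a_0) + a] and the vectors [x_i + e^(i)],
   [i != 0]. *)

(** * Preliminaries on filters and extended reals *)

Lemma filter_bigcap_finite {T : Type} {I : choiceType} (F : set_system T)
    {FF : Filter F} (D : set I) (f : I -> set T) :
  finite_set D -> (forall i, D i -> F (f i)) -> F (\bigcap_(i in D) f i).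
Proof. by move=> /finite_fsetP[X ->] Ff; exact: filter_bigI. Qed.

Lemma lte_between_real (R : realType) (x y : \bar R) :
  (x < y)%E -> exists r : R, (x < r%:E < y)%E.
Proof.
case: x y => [x||] [y||] //=.
- rewrite lte_fin => xy; exists ((x + y) / 2); rewrite !lte_fin.
  by have [-> ->] := (midf_lt xy).
- by move=> _; exists (x + 1); rewrite lte_fin ltrDl ltr01 ltry.
- by move=> _; exists (y - 1); rewrite ltNyr lte_fin gtrBl ltr01.
- by move=> _; exists 0; rewrite ltNyr ltry.
Qed.

(** * The cone cut out by the min-halfspaces of [G] *)

Section Dual.
Context {R : realType} {d : nat}.
Implicit Types (x y a g : 'rV[\bar R]_d.+1) (G : set 'rV[\bar R]_d.+1).

(** The inequality of the sector of [g] in [Mbar], reversed; an existential stands for the minimum,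
    so that proofs receive an index. *)
Definition min_halfspace g : set 'rV[\bar R]_d.+1 :=
  [set x | exists2 j, j \in (supp g :\ ord0)%SET &
    (x ord0 j - g ord0 j <= x ord0 ord0 - g ord0 ord0)%E].

Definition dual_cone G : set 'rV[\bar R]_d.+1 :=
  @Tmin R d `&` \bigcap_(g in G) min_halfspace g.

Lemma fin_supp a i : (a ord0 i \is a fin_num) = (i \in supp a).
Proof. by rewrite inE. Qed.

Lemma supp_nonzero {a} : ord0 \in supp a -> supp a <> [set ord0]%SET ->
  exists j, j \in (supp a :\ ord0)%SET.
Proof.
move=> a0 a1; apply/set0Pn/eqP => aD0; apply: a1; apply/eqP.
by rewrite finset.eqEsubset finset.sub1set a0 andbT -finset.setD_eq0 aD0.
Qed.

Lemma MbarP G x : Mbar G x <-> exists2 g, G g &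
  @Tmax R d x /\ forall j, j \in (supp g :\ ord0)%SET ->
    (x ord0 ord0 - g ord0 ord0 <= x ord0 j - g ord0 j)%E.
Proof.
split=> -[g Gg /= [Tx xg]]; exists g => //; split=> //.
  by have /bigmin_geP[_] := xg.
by apply/bigmin_geP; rewrite leey.
Qed.

Lemma nbhs_coord (T : topologicalType) (n : nat) (x : 'rV[T]_n)
    (i : 'I_n) (P : set T) :
  nbhs (x ord0 i) P -> nbhs x [set y : 'rV[T]_n | P (y ord0 i)].
Proof.
move=> xP.
exists (fun _ j => [set t | j = i -> P t]) => [k j|y].
  2: by move=> /(_ ord0 i erefl).
rewrite (ord1 k); have [->|ji] := eqVneq j i.
  by apply: filterS xP => t Pt _.
by apply: filterE => t ij; rewrite ij eqxx in ji.
Qed.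

Lemma nbhs_real_vec (x : 'rV[R]_d.+1) (P : set 'rV[\bar R]_d.+1) :
  nbhs (real_vec x) P -> nbhs x (@real_vec R d @^-1` P).
Proof.
move=> [Q xQ QP]; exists (fun i j => EFin @^-1` Q i j) => [i j|y yQ].
  by have := xQ i j; rewrite mxE.
by apply: QP => i j; rewrite mxE; exact: yQ.
Qed.

(** The complement is open: a real [r] strictly between the two sides splits each strict inequality
    into open conditions on single coordinates, finitely many in all. *)
Lemma closed_min_halfspace g : ord0 \in supp g -> closed (min_halfspace g).
Proof.
move=> g0 x clx; apply: contrapT => /forall2NP ngx.
suff /clx[y [[j jg yj] /(_ j jg)]] : nbhs x
    [set y | forall j, j \in (supp g :\ ord0)%SET ->
      (y ord0 ord0 - g ord0 ord0 < y ord0 j - g ord0 j)%E].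
  by rewrite ltNge yj.
suff near_j j : nbhs x [set y | j \in (supp g :\ ord0)%SET ->
    (y ord0 ord0 - g ord0 ord0 < y ord0 j - g ord0 j)%E].
  exact: filter_forall near_j.
have [jg|jg] := boolP (j \in (supp g :\ ord0)%SET); last exact: filterE.
have /lte_between_real[r /andP[xr rx]] :
    (x ord0 ord0 - g ord0 ord0 < x ord0 j - g ord0 j)%E.
  rewrite ltNge; apply/negP; by case: (ngx j).
have gj : j \in supp g by move: jg; rewrite in_setD1 => /andP[].
rewrite lteBlDr ?fin_supp// in xr; rewrite lteBrDr ?fin_supp// in rx.
have x0r := nbhs_coord (\bar R) _ x ord0 _ (open_ereal_lt' xr).
have xjr := nbhs_coord (\bar R) _ x j _ (open_ereal_gt' rx).
apply: filterS2 x0r xjr => y /= y0 yj _.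
apply: (@lt_trans _ _ r%:E); first by rewrite lteBlDr ?fin_supp.
by rewrite lteBrDr ?fin_supp.
Qed.

(** The index at which [x] satisfies the halfspace of [g] also serves [y], where the inequality
    becomes strict; so [y] leaves every sector. *)
Lemma not_Mbar_dual_cone G x y : (forall g, G g -> ord0 \in supp g) ->
  dual_cone G x -> (x ord0 ord0 < y ord0 ord0)%E ->
  (forall j, j != ord0 -> (y ord0 j <= x ord0 j)%E) -> ~ Mbar G y.
Proof.
move=> G0 [_ Kx] xy0 yx /MbarP[g Gg [_ yg]].
have [j jg xg] := Kx g Gg.
have j0 : j != ord0 by move: jg; rewrite in_setD1 => /andP[].
have := yg j jg; rewrite leNgt => /negP; apply.
apply: le_lt_trans (leeB (yx j j0) (lexx _)) _; apply: le_lt_trans xg _.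
by rewrite lteD2rE// fin_numN fin_supp G0.
Qed.

(** * [W G] and [Wbar G] as the dual cone *)

Lemma W_dual_cone G : (forall g, G g -> ord0 \in supp g) ->
  W G = [set y | dual_cone G (real_vec y)].
Proof.
move=> G0; apply/seteqP; split=> y /=.
- move=> cly; split=> [i|g Gg]; first by rewrite mxE.
  apply: closed_min_halfspace; first exact: G0.
  move=> P /nbhs_real_vec /cly[z [Mz Pz]]; exists (real_vec z); split=> //.
  apply: contrapT => /forall2NP nz; apply: Mz; apply/MbarP; exists g => //.
  split=> [i|j jg]; first by rewrite mxE.
  by case: (nz j) => // /negP; rewrite -ltNge => /ltW.
- move=> Ky P [Q yQ QP].
  (* Coordinate 0 is raised within the box [Q]. *)
  have [u [Qu yu]] : exists u, Q ord0 ord0 u /\ y ord0 ord0 < u.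
    apply: (@filter_ex _ (y ord0 ord0)^'+); apply: filterI.
      exact: cvg_within (yQ _ _).
    exact: nbhs_right_gt.
  exists (\row_i if i == ord0 then u else y ord0 i); split; last first.
    apply: QP => i j; rewrite (ord1 i) mxE.
    by case: eqP => [->//|_]; exact: nbhs_singleton.
  apply: (not_Mbar_dual_cone _ _ _ G0 Ky).
    by rewrite !mxE eqxx lte_fin.
  by move=> j j0; rewrite !mxE (negbTE j0).
Qed.

Lemma dual_cone_real_vec G : finite_set G ->
  (forall g, G g -> ord0 \in supp g) ->
  (forall g, G g -> supp g <> [set ord0]%SET) ->
  exists z : 'rV[R]_d.+1, dual_cone G (real_vec z).
Proof.
move=> finG G0 G1.
(* Each [g] only asks for [t >= g_0 - g_j] at one index [j] of its support other than 0. *)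
pose z t : 'rV[R]_d.+1 := \row_i if i == ord0 then t else 0.
have [t zt] : exists t : R, (\bigcap_(g in G)
    [set t | min_halfspace g (real_vec (z t))]) t.
  apply: (@filter_ex _ (pinfty_nbhs R)); apply: filter_bigcap_finite => // g Gg.
  have [j jg] := supp_nonzero (G0 g Gg) (G1 g Gg).
  move: (jg); rewrite in_setD1 => /andP[j0].
  have := G0 g Gg; rewrite -!fin_supp => /fineK g0 /fineK gj.
  apply: filterS (@nbhs_pinfty_ge _ (fine (g ord0 ord0) - fine (g ord0 j)) _).
    move=> t tg; exists j => //; rewrite !mxE eqxx (negbTE j0) -g0 -gj.
    by rewrite -!EFinB lee_fin lerBrDr sub0r addrC.
  exact: num_real.
by exists (z t); split=> // i; rewrite !mxE.
Qed.

Lemma dual_cone_min_comb G x y l m : dual_cone G x -> dual_cone G y ->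
  l != -oo%E -> m != -oo%E -> dual_cone G (min_comb l m x y).
Proof.
move=> [Tx Kx] [Ty Ky] l0 m0; split=> [i|g Gg].
  by rewrite mxE /mine; case: ifP => _;
    rewrite adde_eq_ninfty negb_or ?l0 ?m0 ?Tx ?Ty.
(* The term attaining the minimum at coordinate 0 supplies [j]; the other one can only lower the
   left-hand side. *)
case: (leP (l + x ord0 ord0)%E (m + y ord0 ord0)%E) => xy.
- have [j jg xj] := Kx g Gg; exists j => //; rewrite !mxE (min_l xy).
  apply: (@le_trans _ _ (l + x ord0 j - g ord0 j)%E).
    by apply: leeB => //; rewrite ge_min lexx.
  by rewrite -!addeA leeD2l.
- have [j jg yj] := Ky g Gg; exists j => //; rewrite !mxE (min_r (ltW xy)).
  apply: (@le_trans _ _ (m + y ord0 j - g ord0 j)%E).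
    by apply: leeB => //; rewrite ge_min lexx orbT.
  by rewrite -!addeA leeD2l.
Qed.

Lemma Wbar_dual_cone G : finite_set G ->
  (forall g, G g -> ord0 \in supp g) ->
  (forall g, G g -> supp g <> [set ord0]%SET) ->
  Wbar G = dual_cone G.
Proof.
move=> finG G0 G1; rewrite /Wbar (W_dual_cone _ G0).
apply/seteqP; split=> x.
- move=> [clx Tx]; split=> // g Gg; apply: closed_min_halfspace => [|P].
    exact: G0.
  by move=> /clx[_ [[y [_ Ky] <-] Py]]; exists (real_vec y); split=> //;
    exact: Ky.
- move=> Kx; have [Tx _] := Kx; split=> // P [Q xQ QP].
  have [z Kz] := dual_cone_real_vec _ finG G0 G1.
  (* As [t] grows, a coordinate where [x] is finite eventually equals that of [x], and one where [x]
     is infinite tends to +oo. *)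
  have [t xt] : exists t : R, forall i,
      Q ord0 i (min_comb 0%E t%:E x (real_vec z) ord0 i).
    suff near_i i : \forall t \near (pinfty_nbhs R),
        Q ord0 i (min_comb 0%E t%:E x (real_vec z) ord0 i).
      by apply: (@filter_ex _ (pinfty_nbhs R)); exact: filter_forall near_i.
    suff : \forall t \near (pinfty_nbhs R),
        Q ord0 i (mine (x ord0 i) (t%:E + (z ord0 i)%:E)%E).
      by apply: filterS => t; rewrite !mxE add0e.
    have := xQ ord0 i; have := Tx i; case: (x ord0 i) => [r||]// _ rQ.
    + apply: filterS (@nbhs_pinfty_ge _ (r - z ord0 i) _); last exact: num_real.
      move=> t; rewrite lerBlDr -lee_fin EFinD => /min_l ->.
      exact: nbhs_singleton.
    + case: rQ => M [_ MQ].
      apply: filterS (@nbhs_pinfty_gt _ (M - z ord0 i) _); last exact: num_real.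
      move=> t; rewrite ltrBlDr -lte_fin EFinD => Mt.
      by rewrite min_r ?leey//; exact: MQ.
  set c := min_comb _ _ _ _ in xt.
  (* [c] is real because every [t + z_i] is real and no [x_i] is -oo. *)
  have cE : real_vec (map_mx fine c) = c.
    apply/rowP => i; rewrite !mxE add0e.
    by have := Tx i; case: (x ord0 i) => [r||] //= _;
      rewrite ?minye// -EFinD -EFin_min.
  exists c; split; last by apply: QP => i j; rewrite (ord1 i); exact: xt.
  exists (map_mx fine c) => //=; rewrite cE.
  exact: dual_cone_min_comb.
Qed.

(** For finite [x_0], adding the inequality of [a] in the halfspace of [g] to the assumed one at the
    same [j] cancels [a_j] and [a_0]. *)
Lemma dual_coneW G a x : @Tmin R d x -> ord0 \in supp a -> dual_cone G a ->
  (forall j, j \in (supp a :\ ord0)%SET ->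
    (x ord0 j - a ord0 j <= x ord0 ord0 - a ord0 ord0)%E) ->
  (forall g, G g -> ord0 \in supp g) -> dual_cone G x.
Proof.
move=> Tx a0 [Ta Ka] xa G0; split=> // g Gg.
have [j jg ag] := Ka g Gg; exists j => //.
move: (jg); rewrite in_setD1 => /andP[j0 gj].
(* [a_j] is finite because the right-hand side [a_0 - g_0] of [ag] is. *)
have ja : j \in supp a.
  move: a0 (G0 g Gg) gj (Ta j) ag; rewrite -!fin_supp.
  by case: (a ord0 ord0) (g ord0 ord0) (g ord0 j) (a ord0 j)
    => [?||] [?||] [?||] [?||].
have := xa j; rewrite in_setD1 j0 ja => /(_ isT).
move: a0 (G0 g Gg) gj ja ag (Tx j) (Tx ord0); rewrite -!fin_supp.
case: (a ord0 ord0) (g ord0 ord0) (g ord0 j) (a ord0 j) (x ord0 j) (x ord0 ord0)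
  => [a0||] [g0||] [gj||] [aj||] [xj||] [x0||] //= _ _ _ _.
- by rewrite -!EFinB !lee_fin => ? _ _ ?; lra.
- by move=> *; exact: leey.
Qed.

(** * Halfspaces containing [Mbar G] and their apices *)

Lemma apex_const_Ny a h : is_apex a h -> h (const_mx -oo%E).
Proof.
move=> [_ [I [J [_ _ _ IJ ->]]]]; split=> [i|]; first by rewrite mxE.
apply/bigmax_leP; split=> [|i iI]; first exact: leNye.
have : i \in supp a by rewrite -IJ finset.in_setU iI.
by rewrite -fin_supp mxE => /fineK <-; rewrite leNye.
Qed.

Lemma apex_halfspaceP G a h : G !=set0 -> G `<=` @Tmax R d ->
  (forall g, G g -> ord0 \in supp g) -> Mbar G `<=` h -> is_apex a h ->
  [/\ @Tmin R d a, ord0 \in supp a & forall x, h x <-> @Tmax R d x /\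
    exists2 j, j \in (supp a :\ ord0)%SET &
      (x ord0 ord0 - a ord0 ord0 <= x ord0 j - a ord0 j)%E].
Proof.
move=> [g Gg] TG G0 Gh [Ta [I [J [+ + IJ0 IJ hE]]]].
move=> /eqP/set0Pn[i iI] /eqP/set0Pn[j jJ].
have I0 k : k \in I -> k = ord0.
  move=> kI; apply/eqP/negPn/negP => k0.
  (* Having [x_0 = -oo], this point lies in [Mbar G]; but its maximum over [I] is finite, while the
     one over [J] is -oo. *)
  pose x : 'rV[\bar R]_d.+1 := \row_l if l == k then 0%E else -oo%E.
  have Tx : @Tmax R d x by move=> l; rewrite mxE; case: ifP.
  have /Gh : Mbar G x.
    apply/MbarP; exists g => //; split=> // l _.
    by rewrite mxE eq_sym (negbTE k0) addNye leNye.
  rewrite hE => -[_].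
  have ak : k \in supp a by rewrite -IJ finset.in_setU kI.
  move/le_trans => /(_ -oo%E) xk.
  have /xk : (\big[maxe/-oo]_(j in J) (x ord0 j - a ord0 j) <= -oo)%E.
    apply/bigmax_leP; split=> // l lJ.
    rewrite mxE ifF ?addNye//; apply/eqP => lk.
    by have := finset.in_set0 l; rewrite -IJ0 finset.in_setI lJ lk kI.
  move/bigmax_leP => [_ /(_ k kI)]; move: ak.
  by rewrite -fin_supp mxE eqxx => /fineK <-.
have IE : I = [set ord0]%SET.
  apply/setP => k; rewrite finset.in_set1; apply/idP/eqP => [/I0//|->].
  by rewrite -(I0 i iI).
have JE : J = (supp a :\ ord0)%SET.
  apply/setP => k; rewrite -IJ IE in_setD1 finset.in_setU finset.in_set1.
  have := finset.in_set0 k; rewrite -IJ0 IE finset.in_setI finset.in_set1.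
  by case: eqVneq => //= _ ->.
split=> // [|x]; first by rewrite -IJ IE finset.in_setU finset.in_set1 eqxx.
rewrite hE /max_halfspace /= IE big_set1 -JE; split=> -[Tx xa]; split=> //.
(* If [x_0 - a_0] is bounded by the default value -oo of the maximum, every index of [J] works. *)
- case/bigmax_geP: xa => // x0; exists j => //.
  by apply: le_trans x0 _; exact: leNye.
- by apply/bigmax_geP; right.
Qed.

(** Each [g] lies in its own sector, hence in [h]; there [g_0 - a_0 <= g_j - a_j] forces [g_j] to be
    finite and rearranges to [a_j - g_j <= a_0 - g_0]. *)
Lemma apex_dual_cone G a h : G !=set0 -> G `<=` @Tmax R d ->
  (forall g, G g -> ord0 \in supp g) -> Mbar G `<=` h -> is_apex a h ->
  dual_cone G a.
Proof.
move=> G1 TG G0 Gh /(apex_halfspaceP _ _ _ G1 TG G0 Gh)[Ta a0 hP].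
split=> // g Gg.
have /Gh/hP[_ [j ja]] : Mbar G g.
  apply/MbarP; exists g => //; split=> [|j]; first exact: TG.
  rewrite in_setD1 => /andP[_]; move: (G0 g Gg); rewrite -!fin_supp.
  by move=> /subee -> /subee ->.
move: (TG g Gg j) (G0 g Gg) ja; rewrite in_setD1 => gj gg0 /andP[j0 ja] ga.
exists j; rewrite ?in_setD1 ?j0/=; move: a0 gj gg0 ja ga; rewrite -!fin_supp.
all: case: (a ord0 ord0) (g ord0 ord0) (g ord0 j) (a ord0 j)
  => [?||] [?||] [?||] [?||] //= _ _ _ _.
by rewrite -!EFinB !lee_fin => ?; lra.
Qed.

(** The halfspace is chosen before the apex, so any apex of it that [A] contains will serve. If no
    halfspace worked, finiteness of [H] would put a single [z t] in all of them, hence in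
    [Mbar G]. *)
Lemma halfspace_separating G (H : set (set 'rV[\bar R]_d.+1)) x :
  G !=set0 -> G `<=` @Tmax R d -> (forall g, G g -> ord0 \in supp g) ->
  finite_set H -> @Tmax R d `&` \bigcap_(h in H) h = Mbar G ->
  dual_cone G x -> x ord0 ord0 != +oo%E ->
  exists2 h, H h & forall a, is_apex a h ->
    forall j, j \in (supp a :\ ord0)%SET ->
      (x ord0 j - a ord0 j <= x ord0 ord0 - a ord0 ord0)%E.
Proof.
move=> G1 TG G0 finH HG Kx x0; have [Tx _] := Kx.
have MH h : H h -> Mbar G `<=` h by move=> Hh y; rewrite -HG => -[_]; exact.
have x0fin : x ord0 ord0 \is a fin_num by rewrite fin_numE Tx.
apply: contrapT => /forall2NP nH.
pose z t : 'rV[\bar R]_d.+1 := \row_i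
  if i == ord0 then (x ord0 ord0 + t^-1%:E)%E else mine (x ord0 i) t%:E.
(* [z t] tends to [x] from outside [Mbar G] as [t] tends to infinity. *)
have [t [t_gt0 zt]] : exists t : R, 0 < t /\ (\bigcap_(h in H)
    [set t | 0 < t -> h (z t)]) t.
  apply: (@filter_ex _ (pinfty_nbhs R)).
  apply: filterI; first exact: nbhs_pinfty_gt (num_real _).
  apply: filter_bigcap_finite => // h Hh.
  have [//|/existsNP[a /not_implyP[ah]]] := nH h.
  move=> /existsNP[j /not_implyP[ja /negP]].
  rewrite -ltNge => /lte_between_real[r /andP[x0r rxj]].
  have [Ta a0 hP] := apex_halfspaceP _ _ _ G1 TG G0 (MH h Hh) ah.
  move: (ja); rewrite in_setD1 => /andP[/negbTE j0 aj].
  move: a0 aj x0fin; rewrite -!fin_supp.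
  move=> /fineK a0 /fineK aj /fineK x0E.
  rewrite -a0 -x0E -EFinB lte_fin ltrBlDr -subr_gt0 in x0r.
  rewrite -aj lteBrDr// in rxj.
  have t_ge (c : R) : \forall t \near +oo, c <= t.
    exact: nbhs_pinfty_ge (num_real c).
  (* The first bound keeps the cap [t] above [r + a_j]; the second gives [t^-1 <= r + a_0 - x_0].
     The cap is there because [x_j] may be +oo, while [z t] must lie in [Tmax]. *)
  apply: filterS2 (t_ge (r + fine (a ord0 j)))
    (t_ge (r + fine (a ord0 ord0) - fine (x ord0 ord0))^-1) =>
    t tr te t_gt0; apply/hP; split=> [i|].
    rewrite mxE; case: ifP => _; first by rewrite -x0E -EFinD.
    by rewrite -ltey gt_min ltry orbT.
  exists j => //; rewrite !mxE eqxx j0 -a0 -aj -x0E.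
  apply: (@le_trans _ _ r%:E).
    rewrite -EFinD lee_fin lerBlDr -lerBrDl.
    by rewrite -[leRHS]invrK lef_pV2// posrE invr_gt0.
  rewrite leeBrDr// le_min (ltW rxj) /= -EFinD lee_fin.
  exact: tr.
apply: (not_Mbar_dual_cone G x (z t) G0 Kx).
- by rewrite mxE eqxx lteDl ?lte_fin ?invr_gt0.
- by move=> j j0; rewrite mxE (negbTE j0) ge_min lexx.
rewrite -HG; split=> [i|h Hh]; last exact: zt.
rewrite mxE; case: ifP => _; first by rewrite -(fineK x0fin).
by rewrite -ltey gt_min ltry orbT.
Qed.

(** * Generation from the unit vectors, and reflection *)

Lemma min_cone_combine_Emin (D : set 'rV[\bar R]_d.+1) b x :
  min_tropical_cone D -> @Emin R d `<=` D -> D b -> @Tmin R d x ->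
  b ord0 ord0 = x ord0 ord0 -> (forall i, (x ord0 i <= b ord0 i)%E) -> D x.
Proof.
move=> [_ TD combD] ED Db Tx b0 xb.
(* [x] is reached from [b] one coordinate at a time, by a minimum with [x_k + e^(k)]; coordinate 0,
   which has no generator, agrees from the start. *)
pose y (s : seq 'I_d.+1) : 'rV[\bar R]_d.+1 :=
  \row_i if (i \in s) && (i != ord0) then x ord0 i else b ord0 i.
have Dy s : D (y s).
  elim: s => [|k s Ds]; first by congr (D _) : Db; apply/rowP => i; rewrite mxE.
  have [k0|k0] := eqVneq k ord0.
    congr (D _) : Ds; apply/rowP => i; rewrite !mxE in_cons.
    by case: (eqVneq i k) => [->|]; rewrite ?k0 ?eqxx ?andbF.
  have De : D (unit_min R k) by apply: ED; exists k.
  congr (D _) : (combD _ _ 0%E (x ord0 k) Ds De isT (Tx k)).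
  apply/rowP => i; rewrite !mxE add0e in_cons.
  case: (eqVneq i k) => [->|ik] /=.
    by rewrite k0 adde0 min_r//; case: ifP.
  by rewrite addey ?Tx// min_l ?leey.
congr (D _) : (Dy (enum 'I_d.+1)); apply/rowP => i; rewrite mxE mem_enum /=.
by case: eqVneq => // ->.
Qed.

Lemma opp_M_opp (A : set 'rV[\bar R]_d.+1) :
  [set - x | x in M [set trop_opp a | a in A]] =
  [set y | exists2 a, A a & forall j, j \in (supp a :\ ord0)%SET ->
    ((y ord0 j)%:E - a ord0 j <= (y ord0 ord0)%:E - a ord0 ord0)%E]
  :> set 'rV[R]_d.+1.
Proof.
have suppN a : supp (trop_opp a) = supp a.
  by apply/setP => i; rewrite -!fin_supp mxE fin_numN.
(* A real [r] matters: with both terms +oo, the convention +oo - oo = -oo would break this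
   identity. *)
have oppB (r : R) (u : \bar R) : (- (r%:E - u) = (- r)%:E - (- u))%E.
  by case: u => [u||] //; rewrite -!EFinN -!EFinD opprD.
apply/seteqP; split=> y /=.
- move=> [x /MbarP[_ [a Aa <-] [_ xa]] <-]; exists a => // j.
  move: (xa j); rewrite suppN => /[apply].
  by rewrite -leeN2 !mxE !oppB ?oppeK.
- move=> [a Aa ya]; exists (- y); last by rewrite opprK.
  apply/MbarP; exists (trop_opp a); first by exists a.
  split=> [i|j]; first by rewrite !mxE.
  by rewrite suppN => /ya; rewrite !mxE -!oppB leeN2.
Qed.
End Dual.

(** * The cone property, the reflection formula and the generating set *)

Theorem theorem10 (R : realType) (d : nat) (hd : (1 <= d)%N)
    (G : set 'rV[\bar R]_d.+1) (finG : finite_set G)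
    (G_Tmax : G `<=` @Tmax R d)
    (G_supp0 : forall g, G g -> ord0 \in supp g)
    (G_supp : forall g, G g -> supp g <> [set ord0]%SET) :
  min_tropical_cone (Wbar G) /\
  (forall (H : set (set 'rV[\bar R]_d.+1)) (A : set 'rV[\bar R]_d.+1),
     finite_set H ->
     (forall h, H h -> exists a, is_apex a h) ->
     @Tmax R d `&` \bigcap_(h in H) h = Mbar G ->
     apices H A ->
     W G = [set - x | x in M [set trop_opp a | a in A]] /\
     min_generates (A `|` @Emin R d) (Wbar G)).
Proof.
have KE := Wbar_dual_cone G finG G_supp0 G_supp.
have [z Kz] := dual_cone_real_vec G finG G_supp0 G_supp.
have coneK : min_tropical_cone (Wbar G).
  rewrite KE; split; first by exists (real_vec z).
  - by move=> x [].
  - by move=> x y l m; exact: dual_cone_min_comb.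
split=> // H A finH Hapex HG [AH HA].
(* An empty [G] would make [Mbar G] empty, whereas the point with all coordinates -oo lies in every
   halfspace. *)
have G1 : G !=set0.
  have : Mbar G (const_mx -oo%E).
    rewrite -HG; split=> [i|h /Hapex[a]]; first by rewrite mxE.
    exact: apex_const_Ny.
  by case=> g Gg _; exists g.
have MH h : H h -> Mbar G `<=` h by move=> Hh y; rewrite -HG => -[_]; exact.
have KA a : A a -> dual_cone G a.
  by move=> /AH[h /MH]; exact: apex_dual_cone.
have A0 a : A a -> ord0 \in supp a.
  by move=> /AH[h /MH Gh] /(apex_halfspaceP _ _ _ G1 G_Tmax G_supp0 Gh)[].
have sepA x : dual_cone G x -> x ord0 ord0 != +oo%E -> exists2 a, A a &
    forall j, j \in (supp a :\ ord0)%SET ->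
      (x ord0 j - a ord0 j <= x ord0 ord0 - a ord0 ord0)%E.
  move=> Kx x0.
  have [h Hh xh] := halfspace_separating _ _ _ G1 G_Tmax G_supp0 finH HG Kx x0.
  by have [a Aa /xh xa] := HA h Hh; exists a.
split.
  rewrite W_dual_cone// opp_M_opp.
  apply/seteqP; split=> y /=.
  - move=> /sepA; rewrite !mxE => /(_ isT)[a Aa ya].
    by exists a => // j /ya; rewrite !mxE.
  - move=> [a Aa ya]; apply: (dual_coneW G a) => //.
    + by move=> i; rewrite mxE.
    + exact: A0.
    + exact: KA.
    + by move=> j /ya; rewrite !mxE.
split=> //.
  rewrite KE => x [/KA//|[i /= i0 <-]]; split=> [j|g Gg].
    by rewrite mxE; case: ifP.
  have [j jg] := supp_nonzero (G_supp0 g Gg) (G_supp g Gg).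
  (* Coordinate 0 of [e^(i)] is +oo, so any index of [supp g] other than 0 works. *)
  exists j => //; rewrite [unit_min R i ord0 ord0]mxE eq_sym (negbTE i0).
  by move: (G_supp0 g Gg); rewrite -fin_supp => /fineK <-; rewrite addye// leey.
move=> D coneD AED x; rewrite KE => Kx; have [Tx _] := Kx.
have [[b0 Db0] TD combD] := coneD.
have ED : @Emin R d `<=` D by move=> e Ee; apply: AED; right.
(* When [x_0] is +oo, scaling any element of [D] by +oo gives a vector above [x] that agrees with it
   at 0. *)
have [x0|x0] := eqVneq (x ord0 ord0) +oo%E.
  apply: (min_cone_combine_Emin D _ x coneD ED
    (combD _ _ +oo%E +oo%E Db0 Db0 isT isT)) => //.
  - by rewrite mxE !addye ?TD// min_l.
  - by move=> i; rewrite mxE !addye ?TD// min_l// leey.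
have [a Aa xa] := sepA x Kx x0.
have Da : D a by apply: AED; left.
have := A0 a Aa; rewrite -fin_supp => a0.
have l0 : (x ord0 ord0 - a ord0 ord0)%E != -oo%E.
  by rewrite adde_eq_ninfty negb_or Tx -(fineK a0).
(* The vector above [x] is [(x_0 - a_0) + a]; the second scalar +oo reduces [min_comb] to a
   scaling. *)
apply: (min_cone_combine_Emin D _ x coneD ED
  (combD _ _ _ +oo%E Da Da l0 isT)) => //.
- by rewrite mxE addye ?TD// min_l ?leey// subeK.
- move=> i; rewrite mxE addye ?TD// min_l ?leey//.
  have [->|i0] := eqVneq i ord0; first by rewrite subeK.
  have [ai|ai] := boolP (a ord0 i \is a fin_num).
    by rewrite -leeBlDr// xa// in_setD1 i0 -fin_supp.
  have -> : a ord0 i = +oo%E.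
    by move: ai (TD a Da i); case: (a ord0 i).
  by rewrite addey ?leey.
Qed.
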